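(* Let $X$ be an infinite regular cardinal. Then $\mathrm{Pol}(T_1)=\langle\{\mathrm{med}_3\}\cup T_1\rangle$.
   Context: $\mathcal O^{(n)}$ is the set of all functions $X^n\to X$, $\mathcal O=\bigcup_{n\geq 1}\mathcal O^{(n)}$. A clone is a subset of $\mathcal O$ containing all projections and closed under composition; $\langle\mathcal F\rangle$ is the smallest clone containing $\mathcal F$. A function $f\in\mathcal O^{(n)}$ is almost unary if there exist $F\in\mathcal O^{(1)}$ and $1\leq k\leq n$ such that $f(x_1,\ldots,x_n)<F(x_k)$ for all $(x_1,\ldots,x_n)\in X^n$ (here $<$ is the well-order of the cardinal $X$). $T_1$ is the set of all binary almost unary functions. $\mathrm{Pol}(T_1)$ is the set of all $f\in\mathcal O$, say of arity $n$, such that $f(g_1,\ldots,g_n)\in T_1$ for all $g_1,\ldots,g_n\in T_1$. $\mathrm{med}_3\in\mathcal O^{(3)}$ is the median function: $\mathrm{med}_3(x_1,x_2,x_3)=x_{j_2}$ if $\{j_1,j_2,j_3\}=\{1,2,3\}$ and $x_{j_1}\leq x_{j_2}\leq x_{j_3}$. *)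

(* Defs.v *)
From HB Require Import structures.
From mathcomp Require Import all_boot all_order.
From mathcomp Require Import boolp classical_sets functions cardinality.

Set Implicit Arguments.
Unset Strict Implicit.
Unset Printing Implicit Defensive.

Import Order.TTheory.
Local Open Scope classical_set_scope.
Local Open Scope card_scope.
Local Open Scope order_scope.

(* A cardinal is identified with the initial ordinal of that size, i.e. with a
   well-order none of whose proper initial segments has full cardinality.
   Regularity (cf X = X) says that every cofinal subset has full cardinality. *)
Record infinite_regular_cardinal (d : Order.disp_t) (X : orderType d) : Prop := {
  rc_wf : well_founded (fun x y : X => x < y);
  rc_infinite : infinite_set [set: X];
  rc_initial : forall x : X, ~ ([set y | y < x] #= [set: X]);
  rc_regular : forall A : set X,
    (forall x, exists2 y, A y & x <= y) -> A #= [set: X]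
}.

Definition op (X : Type) (n : nat) := ('I_n -> X) -> X.

(* All arities are at least 1: [Op f] has arity [n.+1] for [f : op X n.+1]. *)
Definition ops (X : Type) := {n : nat & op X n.+1}.

Definition Op (X : Type) (n : nat) (f : op X n.+1) : ops X :=
  existT (fun m => op X m.+1) n f.

Definition arity (X : Type) (f : ops X) : nat := (projT1 f).+1.

Definition op_of (X : Type) (f : ops X) : op X (arity f) := projT2 f.

Arguments op_of {X} f _.

Definition op_proj (X : Type) (n : nat) (k : 'I_n) : op X n := fun x => x k.

Definition op_comp (X : Type) (n m : nat) (f : op X n) (g : 'I_n -> op X m) :
  op X m := fun x => f (fun i => g i x).

Definition is_clone (X : Type) (C : set (ops X)) : Prop :=
  (forall n (k : 'I_n.+1), C (Op (@op_proj X n.+1 k))) /\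
  (forall n m (f : op X n.+1) (g : 'I_n.+1 -> op X m.+1),
    C (Op f) -> (forall i, C (Op (g i))) -> C (Op (op_comp f g))).

Definition clone_gen (X : Type) (F : set (ops X)) : set (ops X) :=
  smallest (@is_clone X) F.

Definition almost_unary d (X : orderType d) (n : nat) (f : op X n) : Prop :=
  exists (F : X -> X) (k : 'I_n), forall x : 'I_n -> X, f x < F (x k).

Definition T1 d (X : orderType d) : set (op X 2) :=
  [set f | almost_unary f].

Definition Pol (X : Type) (m : nat) (S : set (op X m)) : set (ops X) :=
  [set f | forall g : 'I_(arity f) -> op X m,
             (forall i, S (g i)) -> S (op_comp (op_of f) g)].

Definition med3 d (X : orderType d) : op X 3 :=
  fun x => nth (x ord0) (sort <=%O [seq x i | i <- enum 'I_3]) 1.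

Lemma med3E d (X : orderType d) (x : 'I_3 -> X) (j1 j2 j3 : 'I_3) :
  [set j1; j2; j3]%SET = [set: 'I_3]%SET -> x j1 <= x j2 -> x j2 <= x j3 ->
  med3 x = x j2.
Proof.
move=> jE le12 le23.
have pj : perm_eq [:: j1; j2; j3] (enum 'I_3).
  have sub : {subset enum 'I_3 <= [:: j1; j2; j3]}.
    move=> i _; have : i \in [set j1; j2; j3]%SET by rewrite jE inE.
    by rewrite !inE -orbA.
  have sz : (size [:: j1; j2; j3] <= size (enum 'I_3))%N by rewrite size_enum_ord.
  have [_ eqm] := uniq_min_size (enum_uniq 'I_3) sub sz.
  rewrite uniq_perm ?enum_uniq //.
  by rewrite -(eq_uniq _ eqm) ?enum_uniq // size_enum_ord.
rewrite /med3 -[RHS]/(nth (x ord0) [seq x i | i <- [:: j1; j2; j3]] 1).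
congr nth; apply: le_sorted_eq.
- exact: sort_le_sorted.
- by rewrite /= le12 le23.
- by rewrite perm_sort perm_sym perm_map.
Qed.

(* Main.v *)
Require Import Defs.
From mathcomp Require Import all_boot all_order.
From mathcomp Require Import boolp classical_sets functions cardinality.

(** Why the theorem is true.

    One inclusion is routine: [Pol T1] is a clone; it contains [T1] because,
    by regularity, every unary function is bounded on proper initial segments;
    and it contains the median because two of any three functions in [T1]
    are controlled by the same variable, and the median lies below the larger
    of these two.

    For the converse, let [f] in [Pol T1] be [n]-ary.  Say that a set [A] of
    variables controls [f] if a bound on the variables in [A] implies a bound
    on [f].

    - For every [A], either [A] or its complement controls [f]
      ([controls_or_setC]).  Otherwise [f] is unbounded along two families of
      arguments, one with the variables in [A] bounded, the other with the
      remaining variables bounded.  Placing them on a column and on a row of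
      [X * X] gives almost unary [g_i] such that [f(g_1, .., g_n)] is unbounded
      both on a column and on a row, hence not almost unary.

    - There is a median term [h] such that the variables below [h x] always
      form a controlling set, so that [f x < F (h x)] for some unary [F]
      ([Pol_dominated]).  The sets whose complement does not control [f] meet
      pairwise, and for every finite pairwise intersecting family there is a
      median term whose value, for each member [B], is always at least as large
      as some variable in [B] ([med3_catches_intersecting]).  This is an induction on the size
      of the family: take the median of three terms, each of which neglects
      a different member.

    - A function dominated by [F \o h], with [h] in a clone containing [T1],
      is in this clone ([dominated_in_clone]).  Binary almost unary functions
      can code pairs [(x, y)] with [y <= x], and hence a tuple [w] together
      with an upper bound [s] of its entries ([code]).  If [x_j] is the largest
      variable, then [code x_j x] determines the whole of [x], and hence [f x];
      the binary function which looks up this value and truncates it at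
      [F (h x)] is almost unary.  This gives [n] candidates for [f x], all at
      most [F (h x)]; coding them together with [F (h x)] leaves it to a unary
      function to pick the right one.

    The injectivity of the coding of pairs is where regularity enters again: it
    makes it possible to define, by greedy recursion, a map from the pairs
    [y <= x] to [X] that increases strictly in the lexicographic order
    ([exists_pairing]), without any appeal to the arithmetic of cardinals. *)

Set Implicit Arguments.
Unset Strict Implicit.
Unset Printing Implicit Defensive.

Import Order.TTheory.
Local Open Scope classical_set_scope.

(** * Regularity and the coding of pairs *)

Section RegularCardinal.
Local Open Scope order_scope.
Local Open Scope card_scope.

Variables (d : Order.disp_t) (X : orderType d).
Hypothesis hX : infinite_regular_cardinal X.

(** Otherwise the singleton of the maximum would be cofinal. *)
Lemma exists_gt (x : X) : exists y, x < y.
Proof.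
case: (pselect (exists y, x < y)) => // nx; case: (rc_infinite hX).
have lex y : y <= x by rewrite leNgt; apply/negP => xy; apply: nx; exists y.
have /eq_finite_set <- : [set x] #= [set: X]; last exact: finite_set1.
by apply: (rc_regular hX) => y; exists x.
Qed.

(** An unbounded image of a proper initial segment would be cofinal, hence of
    full cardinality, and so would be the segment. *)
Lemma segment_bounded (G : X -> X) (z : X) :
  exists b, forall y, y <= z -> G y < b.
Proof.
apply: contrapT => nb.
have [z' zz'] := exists_gt z.
apply: (rc_initial hX (x := z')); rewrite card_eq_le; apply/andP; split.
  exact: subset_card_le.
pose A := G @` [set y | y <= z].
have cofA : A #= [set: X].
  apply: (rc_regular hX) => b; apply: contrapT => nA; apply: nb; exists b => y yz.
  rewrite ltNge; apply/negP => bG; apply: nA; exists (G y) => //.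
  by exists y.
move: cofA; rewrite card_eq_le => /andP[_ XA].
apply: card_le_trans XA _; apply: card_le_trans (card_image_le _ _) _.
by apply: subset_card_le => y /= yz; apply: le_lt_trans zz'.
Qed.

(** The form in which regularity is used: [F] witnesses that
    [(z, y) |-> G z y], cut off at [y <= z], is almost unary. *)
Lemma segments_bounded (G : X -> X -> X) :
  exists F, forall z y, y <= z -> G z y < F z.
Proof.
have /choice[F HF] : forall z, exists b, forall y, y <= z -> G z y < b.
  by move=> z; apply: segment_bounded.
by exists F.
Qed.

(** Well-founded recursion in which each value is chosen strictly above what the
    previous values demand; these demands are bounded by [segment_bounded]. *)
Lemma greedy_rec (lo : X -> X) (Phi : X -> X -> X) :
  exists g : X -> X, (forall y, lo y < g y) /\
    forall y' y, y' < y -> Phi y' (g y') < g y.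
Proof.
have step (y : X) (rec : forall y', y' < y -> X) :
    exists b, lo y < b /\ forall y' (h : y' < y), Phi y' (rec y' h) < b.
  pose G y' := if pselect (y' < y) is left h then Phi y' (rec y' h) else lo y.
  have [b Gb] := segment_bounded G y.
  exists b; split.
    have := Gb y (lexx y); rewrite /G; case: pselect => // h.
    by have := h; rewrite ltxx.
  move=> y' h; have := Gb y' (ltW h); rewrite /G; case: pselect => // h'.
  by rewrite (bool_irrelevance h h').
pose g := Fix (rc_wf hX) (fun=> X) (fun y rec => projT1 (cid (step y rec))).
have gE y : g y = projT1 (cid (step y (fun y' _ => g y'))).
  rewrite /g Fix_eq // => {}y r r' rr'.
  suff -> : r = r' by [].
  apply: functional_extensionality_dep => y'.
  exact: functional_extensionality_dep.
by exists g; split=> [y|y' y h]; rewrite (gE y); case: cid => b /= [] // _; apply.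
Qed.

(** The pairing is an ordinal sum: the block [c x _] is a copy of [X] that starts
    at [beta x], chosen beyond the part [y <= x'] of every block [x' < x].
    Hence [c] is strictly increasing in the lexicographic order on the pairs
    [(x, y)] with [y <= x]. *)
Lemma exists_pairing : exists c : X -> X -> X,
  (forall x y, x < c x y) /\
  forall x y x' y', y <= x -> y' <= x' -> c x y = c x' y' -> x = x' /\ y = y'.
Proof.
have /choice[e He] : forall b, exists e : X -> X,
    (forall y, b < e y) /\ {homo e : y' y / y' < y}.
  by move=> b; apply: (greedy_rec (fun=> b) (fun _ v => v)).
(* as [e v] is increasing, [e v x] bounds the whole block on [y <= x] *)
have [beta [lobeta mbeta]] := greedy_rec id (fun x v => e v x).
exists (fun x y => e (beta x) y); split=> [x y|x y x' y' yx yx'].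
  by apply: lt_trans (lobeta x) _; case: (He (beta x)).
have emono b : {mono e b : y' y / y' <= y} by apply: le_mono; case: (He b).
have lexlt a u a' u' : u <= a -> a < a' -> e (beta a) u < e (beta a') u'.
  move=> ua aa'; apply: (@le_lt_trans _ _ (e (beta a) a)); first by rewrite emono.
  by apply: lt_trans (mbeta _ _ aa') _; case: (He (beta a')).
case: (ltgtP x x') => [xx'|xx'|xx'].
- by move=> E; have := lexlt _ _ _ y' yx xx'; rewrite E ltxx.
- by move=> E; have := lexlt _ _ _ y yx' xx'; rewrite E ltxx.
- by rewrite -xx' => E; split=> //; apply: (inc_inj (emono _) E).
Qed.

End RegularCardinal.

(** * Coding tuples by almost unary functions *)

Section TruncatedCoding.
Local Open Scope order_scope.

Variables (d : Order.disp_t) (X : orderType d) (c : X -> X -> X).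
Hypothesis c_gt : forall x y, x < c x y.
Hypothesis c_inj : forall x y x' y',
  y <= x -> y' <= x' -> c x y = c x' y' -> x = x' /\ y = y'.

(** Cutting [y] off at [s] makes the coding almost unary in [s]. *)
Definition trunc (s y : X) : X := c s (Order.min y s).

(** Starting from [c s s], which exceeds [s], lets entries equal to [s] survive
    the truncation, which is faithful only strictly below the first argument. *)
Definition code n (s : X) (w : 'I_n -> X) : X :=
  foldl trunc (c s s) [seq w i | i <- enum 'I_n].

(** Only one of the two sequences has to be below the start value: if the last
    step of decoding yields an entry strictly below the accumulated code, then
    that entry cannot come from a truncation. *)
Lemma foldl_trunc_inj s s' w w' : size w = size w' -> all (< s) w ->
  foldl trunc s w = foldl trunc s' w' -> s = s' /\ w = w'.
Proof.
elim: w w' s s' => [|y w IH] [|y' w'] //= s s' [sz] /andP[ys ws] E.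
have ws' : all (< trunc s y) w.
  by apply: sub_all ws => z zs; apply: lt_trans zs (c_gt _ _).
have [+ ->] := IH _ _ _ sz ws' E.
move=> /c_inj[]; [by rewrite ge_min lexx orbT..|move=> <-].
rewrite (min_l (ltW ys)); case: leP => [_ -> //|_ ys'].
by rewrite ys' ltxx in ys.
Qed.

Lemma code_inj n s s' (w w' : 'I_n -> X) : (forall i, w i <= s) ->
  code s w = code s' w' -> s = s' /\ w = w'.
Proof.
move=> ws /foldl_trunc_inj[|| + E]; first by rewrite !size_map.
  by apply/allP => _ /mapP[i _ ->]; apply: le_lt_trans (ws i) (c_gt _ _).
move=> /c_inj[] // -> _; split=> //; apply: funext => i.
by have /eq_in_map/(_ i) := E; apply; rewrite mem_enum.
Qed.

(** By the asymmetry in [code_inj], a tuple with an entry above [s] shares its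
    code with no pair whose entries are properly bounded, so that a decoder can
    answer [None] on it. *)
Lemma exists_decoder n : exists dec : X -> option (X * ('I_n -> X)),
  forall s w, dec (code s w) = if [forall i, w i <= s] then Some (s, w) else None.
Proof.
have /choice[dec decP] : forall b, exists r : option (X * ('I_n -> X)),
    forall s w, b = code s w ->
      r = if [forall i, w i <= s] then Some (s, w) else None.
  move=> b; have [[s [w [ws bE]]]|nb] :=
      pselect (exists s w, (forall i : 'I_n, w i <= s) /\ b = code s w).
    exists (Some (s, w)) => s' w'; rewrite bE => /(code_inj ws)[<- <-].
    by case: forallP.
  exists None => s w bE; case: forallP => // ws.
  by case: nb; exists s, w.
by exists dec => s w; apply: decP.
Qed.

End TruncatedCoding.

(** * Clones and the median *)

Section Clones.
Local Open Scope order_scope.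

Lemma clone_gen_is_clone (Y : Type) (F : set (ops Y)) : is_clone (clone_gen F).
Proof.
split=> [n k C [[Cproj _] _]|n m f g Cf Cg C CF]; first exact: Cproj.
by have [[_ Ccomp] _] := CF; apply: Ccomp => [|i]; [apply: Cf|apply: Cg].
Qed.

Lemma Pol_is_clone (Y : Type) m (S : set (op Y m)) : is_clone (Pol S).
Proof.
split=> [n k g Sg|n l f g Pf Pg h Sh]; first exact: Sg.
by apply: Pf => i; apply: Pg.
Qed.

Variables (d : Order.disp_t) (X : orderType d).

Lemma med3_sorted (x : 'I_3 -> X) : exists j1 j2 j3 : 'I_3,
  [/\ [set j1; j2; j3]%SET = [set: 'I_3]%SET, x j1 <= x j2 & x j2 <= x j3].
Proof.
have perm3 (j1 j2 j3 : 'I_3) : uniq [:: j1; j2; j3] ->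
    [set j1; j2; j3]%SET = [set: 'I_3]%SET.
  move=> u; apply/eqP; rewrite eqEcard finset.subsetT /=.
  apply: (@leq_trans #|[:: j1; j2; j3]|).
    by rewrite cardsT card_ord (card_uniqP u).
  by apply/subset_leq_card/fintype.subsetP => i; rewrite !inE -orbA.
pose a : 'I_3 := ord0; pose b : 'I_3 := Ordinal (isT : (1 < 3)%N).
pose e : 'I_3 := ord_max.
case: (leP (x a) (x b)) => [ab|/ltW ba]; case: (leP (x b) (x e)) => [be|/ltW eb].
- by exists a, b, e; rewrite perm3.
- case: (leP (x a) (x e)) => [ae|/ltW ea]; first by exists a, e, b; rewrite perm3.
  by exists e, a, b; rewrite perm3.
- case: (leP (x a) (x e)) => [ae|/ltW ea]; first by exists b, a, e; rewrite perm3.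
  by exists b, e, a; rewrite perm3.
- by exists e, b, a; rewrite perm3.
Qed.

(** Among any two of the three positions in sorted order, one is at or below and
    one at or above the middle. *)
Lemma med3_middle (x : 'I_3 -> X) (i j : 'I_3) : i != j ->
  Order.min (x i) (x j) <= med3 x <= Order.max (x i) (x j).
Proof.
have [j1 [j2 [j3 [E x12 x23]]]] := med3_sorted x; rewrite (med3E E x12 x23).
have in3 k : [|| k == j1, k == j2 | k == j3].
  by have := finset.in_setT k; rewrite -E !inE -orbA.
rewrite ge_min le_max => ij.
case/or3P: (in3 i) => /eqP iE; case/or3P: (in3 j) => /eqP jE; move: ij;
  by rewrite iE jE ?eqxx ?lexx ?x12 ?x23 ?orbT.
Qed.

Lemma med3_ge (x : 'I_3 -> X) (i j : 'I_3) z :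
  i != j -> z <= x i -> z <= x j -> z <= med3 x.
Proof.
move=> /(med3_middle x)/andP[+ _] zi zj; apply: le_trans.
by rewrite le_min zi zj.
Qed.

Lemma med3_lt (x : 'I_3 -> X) (i j : 'I_3) z :
  i != j -> x i < z -> x j < z -> med3 x < z.
Proof.
move=> /(med3_middle x)/andP[_ +] zi zj => /le_lt_trans; apply.
by rewrite gt_max zi zj.
Qed.

End Clones.

(** * Properties of [Pol T1] *)

Section PolContains.
Local Open Scope order_scope.
Variables (d : Order.disp_t) (X : orderType d).
Hypothesis hX : infinite_regular_cardinal X.

(** Two of the three inner functions are almost unary in the same variable. *)
Lemma med3_Pol : Pol (@T1 d X) (Op (@med3 d X)).
Proof.
move=> g /choice[F /choice[k gF]].
have [i [j [ij kij]]] : exists i j : 'I_3, i != j /\ k i = k j.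
  apply: contrapT => nk; have /leq_card : injective k.
    by move=> i j kij; apply/eqP/negPn/negP => ij; apply: nk; exists i, j.
  by rewrite !card_ord.
exists (fun z => Order.max (F i z) (F j z)), (k i) => y.
apply: (med3_lt ij); rewrite /= lt_max; first by rewrite gF.
by rewrite kij gF orbT.
Qed.

Lemma T1_Pol (f : op X 2) : T1 f -> Pol (@T1 d X) (Op f).
Proof.
move=> [F [k fF]] g /(_ k)[G [l gG]].
have [b bP] := segments_bounded hX (fun z y => F y).
exists (fun z => b (G z)), l => y.
by apply: lt_trans (fF _) _; apply: bP; apply/ltW/gG.
Qed.

Lemma clone_gen_sub_Pol :
  clone_gen ([set Op (@med3 d X)] `|` [set Op f | f in @T1 d X]) `<=`
  Pol (@T1 d X).
Proof.
apply: smallest_sub; first exact: Pol_is_clone.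
move=> _ [->|[f Tf <-]]; [exact: med3_Pol|exact: T1_Pol].
Qed.

(** With the empty set, this says that [f] is bounded. *)
Definition controls n (f : op X n) (A : {set 'I_n}) : Prop :=
  forall z, exists b, forall x, (forall i, i \in A -> x i <= z) -> f x < b.

(** If both fail, there are [a] and [p v] with the [A]-entries of [p v] at most
    [a] and [v <= f (p v)], and likewise [b] and [q v] for the complement.
    Putting [p] on the line [y0 = a] and [q] on the line [y1 = b] makes the
    [A]-components almost unary in [y0] and the others almost unary in [y1],
    whereas their composition with [f] is unbounded on both lines. *)
Lemma controls_or_setC n (f : op X n.+1) (A : {set 'I_n.+1}) :
  Pol (@T1 d X) (Op f) -> controls f A \/ controls f (~: A)%SET.
Proof.
move=> Pf; apply: contrapT => /not_orP[].
have escape B : ~ controls f B -> exists a, exists p : X -> 'I_n.+1 -> X,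
    forall v, (forall i, i \in B -> p v i <= a) /\ v <= f (p v).
  move=> /existsNP[a /forallNP nb]; exists a.
  have /choice[p pP] : forall v, exists x,
      (forall i, i \in B -> x i <= a) /\ v <= f x.
    by move=> v; have /existsNP[x /not_implyP[xa /negP]] := nb v; rewrite -leNgt; exists x.
  by exists p.
move=> /escape[a [p pP]] /escape[b [q qP]].
pose g i (y : 'I_2 -> X) := if y ord0 == a then p (y ord_max) i
                            else if y ord_max == b then q (y ord0) i else a.
have Tg i : T1 (g i).
  have [s sP] := segments_bounded hX (fun z y => y).
  case: (boolP (i \in A)) => iA.
    exists (fun u => s (Order.max a (q u i))), ord0 => y; apply: sP; rewrite /g.
    case: eqP => _; first by rewrite le_max (pP _).1.
    by case: eqP => _; rewrite le_max lexx ?orbT.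
  exists (fun u => s (Order.max (Order.max a b) (p u i))), ord_max => y.
  apply: sP; rewrite /g; case: eqP => _; first by rewrite le_max lexx orbT.
  by case: eqP => _; rewrite !le_max ?lexx // (qP _).1 ?inE ?iA ?orbT.
have [F [k gF]] := Pf g Tg.
pose pt (u v : X) (i : 'I_2) : X := if i == ord0 then u else v.
case: (eqVneq k ord0) => [k0|k1].
  have := gF (pt a (F a)); rewrite k0 /op_comp /op_of /= /pt /= /g /= eqxx.
  by rewrite ltNge (pP _).2.
have kE : k = ord_max by apply/val_inj; case: (k) k1 => -[|[|]].
rewrite {}kE in gF.
(* [v] must differ from [a], since the line [y0 = a] takes precedence *)
have [v vP] := exists_gt hX (Order.max a (F b)).
move: vP; rewrite gt_max => /andP[av Fv].
have := gF (pt v b); rewrite /op_comp /op_of /= /g /pt /= eqxx (gt_eqF av).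
by rewrite ltNge (le_trans (ltW Fv) (qP _).2).
Qed.

End PolContains.

(** * Generating functions from the median and [T1] *)

Section Generation.
Local Open Scope order_scope.
Variables (d : Order.disp_t) (X : orderType d).
Hypothesis hX : infinite_regular_cardinal X.
Variable C : set (ops X).
Hypothesis C_clone : is_clone C.

Lemma clone_proj n (k : 'I_n.+1) : C (Op (fun x => x k)).
Proof. exact: C_clone.1. Qed.

(** Equivalently, the set of the [i] with [x i <= h x] is never contained in the
    complement of [B]. *)
Definition catches n (h : op X n) (B : {set 'I_n}) :=
  forall x, exists2 i, i \in B & x i <= h x.

(** The median is at least the smaller of two of its arguments. *)
Lemma med3_catches n (h : 'I_3 -> op X n) (B : {set 'I_n}) (j k : 'I_3) :
  j != k -> catches (h j) B -> catches (h k) B ->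
  catches (op_comp (@med3 d X) h) B.
Proof.
move=> jk hj hk x; have [i iB xi] := hj x; have [l lB xl] := hk x.
have [il|/ltW li] := leP (x i) (x l).
  by exists i => //; apply: (med3_ge jk) => //; apply: le_trans xl.
by exists l => //; apply: (med3_ge jk) => //; apply: le_trans xi.
Qed.

(** Up to two sets are caught by the projection to a common element.  From three
    sets on, the induction hypothesis provides three terms, each neglecting
    a different one of the first three sets, so that every set is caught by at
    least two of them and hence by their median. *)
Lemma med3_catches_intersecting n (Bs : seq {set 'I_n.+1}) :
  C (Op (@med3 d X)) ->
  (forall B B', B \in Bs -> B' \in Bs -> exists2 i, i \in B & i \in B') ->
  exists2 h, C (Op h) & {in Bs, forall B, catches h B}.
Proof.
move=> Cmed; have [m] := ubnP (size Bs); elim: m Bs => // m IH.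
case=> [|B1 [|B2 [|B3 Bs]]] ltm int.
- by exists (fun x => x ord0); first exact: clone_proj.
- have [i iB _] := int B1 B1 (mem_head _ _) (mem_head _ _).
  exists (fun x => x i); first exact: clone_proj.
  by move=> B; rewrite inE => /eqP -> x; exists i.
- have [||i i1 i2] := int B1 B2; rewrite ?inE ?eqxx ?orbT //.
  exists (fun x => x i); first exact: clone_proj.
  by move=> B; rewrite !inE => /orP[]/eqP -> x; exists i.
have sub (s : seq {set 'I_n.+1}) : (size s < m)%N ->
    {subset s <= [:: B1, B2, B3 & Bs]} ->
    exists2 h, C (Op h) & {in s, forall B, catches h B}.
  by move=> sm sB; apply: IH => // B B' /sB + /sB; apply: int.
have [||h1 C1 H1] := sub [:: B2, B3 & Bs]; [exact: ltm| |].
  by move=> B; rewrite !inE => /or3P[]->; rewrite ?orbT.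
have [||h2 C2 H2] := sub [:: B1, B3 & Bs]; [exact: ltm| |].
  by move=> B; rewrite !inE => /or3P[]->; rewrite ?orbT.
have [||h3 C3 H3] := sub [:: B1, B2 & Bs]; [exact: ltm| |].
  by move=> B; rewrite !inE => /or3P[]->; rewrite ?orbT.
pose h (i : 'I_3) := nth h1 [:: h1; h2; h3] i.
exists (op_comp (@med3 d X) h).
  by apply: C_clone.2 => // -[[|[|[|i]]] ? //].
pose j1 : 'I_3 := ord0; pose j2 : 'I_3 := Ordinal (isT : (1 < 3)%N).
pose j3 : 'I_3 := ord_max.
move=> B; rewrite !inE => /or4P[BE|BE|BE|BE].
- by apply: (@med3_catches _ _ _ j2 j3) => //; [apply: H2|apply: H3]; rewrite !inE BE.
- by apply: (@med3_catches _ _ _ j1 j3) => //; [apply: H1|apply: H3]; rewrite !inE BE ?orbT.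
- by apply: (@med3_catches _ _ _ j1 j2) => //; [apply: H1|apply: H2]; rewrite !inE BE ?orbT.
- by apply: (@med3_catches _ _ _ j1 j2) => //; [apply: H1|apply: H2]; rewrite !inE BE ?orbT.
Qed.

(** A term [h] that catches all sets [B] whose complement does not control [f] is
    such that [A := {i | x i <= h x}] always controls [f]: otherwise [h] would
    catch the complement of [A] at [x], which is absurd. *)
Lemma Pol_dominated n (f : op X n.+1) :
  C (Op (@med3 d X)) -> Pol (@T1 d X) (Op f) ->
  exists2 h, C (Op h) & exists F : X -> X, forall x, f x < F (h x).
Proof.
move=> Cmed Pf.
pose Bs :=
  [seq B : {set 'I_n.+1} <- enum {set 'I_n.+1} | ~~ `[< controls f (~: B)%SET >]].
have inBs B : (B \in Bs) = ~~ `[< controls f (~: B)%SET >].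
  by rewrite mem_filter mem_enum andbT.
have [|h Ch hB] := @med3_catches_intersecting n Bs Cmed.
  (* if [B'] misses [B], then [~: B] contains the controlling set [B'] *)
  move=> B B'; rewrite !inBs => /asboolP nB /asboolP nB'.
  apply: contrapT => disj; apply: nB.
  have [bB'|//] := controls_or_setC hX B' Pf.
  move=> z; have [b bP] := bB' z; exists b => x xz; apply: bP => i iB'.
  by apply: xz; rewrite inE; apply/negP => iB; apply: disj; exists i.
exists h => //.
have /choice[G GP] : forall A, exists G : X -> X, controls f A ->
    forall z x, (forall i, i \in A -> x i <= z) -> f x < G z.
  move=> A; case: (pselect (controls f A)) => [/choice[G GP]|nA].
    by exists G => _.
  by exists id.
exists (fun z => \big[Order.max/z]_(A : {set 'I_n.+1}) G A z) => x.
pose A := [set i | x i <= h x]%SET.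
suff bA : controls f A.
  by apply: lt_le_trans (le_bigmax _ _ A); apply: GP => // i; rewrite inE.
apply: contrapT => nA.
have /hB/(_ x)[i] : (~: A)%SET \in Bs by rewrite inBs finset.setCK; apply/asboolP.
by rewrite !inE => /negP.
Qed.

Hypothesis C_T1 : forall f, T1 f -> C (Op f).

Lemma clone_binary n (phi : X -> X -> X) (F : X -> X) (u v : op X n.+1) :
  (forall a b, phi a b < F a) -> C (Op u) -> C (Op v) ->
  C (Op (fun x => phi (u x) (v x))).
Proof.
move=> phiF Cu Cv.
have := @C_clone.2 1 n (fun y => phi (y ord0) (y ord_max))
  (fun i => if i == ord0 then u else v).
apply; first by apply: C_T1; exists F, ord0 => y; apply: phiF.
by move=> i; case: ifP.
Qed.

Lemma clone_unary n (D : X -> X) (u : op X n.+1) :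
  C (Op u) -> C (Op (fun x => D (u x))).
Proof.
move=> Cu; have [F FP] := segments_bounded hX (fun a _ => D a).
by apply: (clone_binary (phi := fun a _ => D a) (F := F) _ Cu Cu) => a b; apply: FP.
Qed.

Lemma clone_code c n m (u : op X n.+1) (w : 'I_m -> op X n.+1) :
  C (Op u) -> (forall i, C (Op (w i))) ->
  C (Op (fun x => code c (u x) (fun i => w i x))).
Proof.
move=> Cu Cw; rewrite /code.
have fold_in s (v : op X n.+1) : C (Op v) ->
    C (Op (fun x => foldl (trunc c) (v x) [seq w i x | i <- s])).
  elim: s v => [|i s IH] v Cv //=.
  apply: (IH (fun x => trunc c (v x) (w i x))).
  have [F FP] := segments_bounded hX c.
  apply: (clone_binary (phi := trunc c) (F := F)) => // a b.
  by apply: FP; rewrite ge_min lexx orbT.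
exact: (fold_in _ (fun x => c (u x) (u x))) (@clone_unary _ (fun s => c s s) _ Cu).
Qed.

(** The values [w j x], which look up [f] at the argument decoded from
    [code (x j) x], equal [f x] for maximal [x j]; for the other [j] they are
    either [f x] as well or [F (h x)], a value which [f x] never takes.  So the
    entries of the tuple [w x] below [F (h x)] all equal [f x]. *)
Lemma dominated_in_clone n (f h : op X n.+1) (F : X -> X) :
  C (Op h) -> (forall x, f x < F (h x)) -> C (Op f).
Proof.
move=> Ch fF; have [c [c_gt c_inj]] := exists_pairing hX.
have [dec decP] := exists_decoder c_gt c_inj n.+1.
pose t j (x : 'I_n.+1 -> X) := code c (x j) x.
have Ct j : C (Op (t j)) by apply: (@clone_code c n n.+1) => [|i]; apply: clone_proj.
pose phi a b := if dec b is Some (_, y) then Order.min (f y) (F a) else F a.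
have phi_le a b : phi a b <= F a.
  by rewrite /phi; case: (dec b) => [[_ y]|//]; rewrite ge_min lexx orbT.
pose w j x := phi (h x) (t j x).
have Cw j : C (Op (w j)).
  have [G GP] := segments_bounded hX (fun _ y => y).
  by apply: (clone_binary (phi := phi) (F := fun a => G (F a))) => // a b; apply: GP.
have wE j x : w j x = if [forall i, x i <= x j] then f x else F (h x).
  rewrite /w /phi decP; case: ifP => // _.
  by apply: min_l; apply: ltW.
pose S x := code c (F (h x)) (fun j => w j x).
have CS : C (Op S).
  by apply: (@clone_code c n n.+1 (fun x => F (h x)) w) => //; apply: clone_unary.
have decS x : dec (S x) = Some (F (h x), fun j => w j x).
  by rewrite decP; case: forallP => // -[] j; apply: phi_le.
pose D b := if dec b is Some (s, v) then
              if [pick j | v j < s] is Some j then v j else s else b.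
suff -> : f = fun x => D (S x) by apply: clone_unary.
apply: funext => x; rewrite /D decS.
case: pickP => [j|none]; first by rewrite wE; case: ifP; rewrite ?ltxx.
pose j := [arg max_(i > ord0) x i]%O.
have xj : [forall i, x i <= x j].
  by apply/forallP => i; rewrite /j; case: arg_maxP => // k _; apply.
by have := none j; rewrite wE xj fF.
Qed.

End Generation.

Theorem theorem47 (d : Order.disp_t) (X : orderType d)
    (hX : infinite_regular_cardinal X) :
  Pol (@T1 d X) =
  clone_gen ([set Op (@med3 d X)] `|` [set Op f | f in @T1 d X]).
Proof.
apply/seteqP; split; last exact: clone_gen_sub_Pol.
set C := clone_gen _ => -[n f] Pf.
have C_clone : is_clone C by apply: clone_gen_is_clone.
have Cmed : C (Op (@med3 d X)) by apply: sub_gen_smallest; left.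
have CT1 g : T1 g -> C (Op g).
  by move=> Tg; apply: sub_gen_smallest; right; exists g.
have [h Ch [F fF]] := Pol_dominated hX C_clone Cmed Pf.
exact: (dominated_in_clone hX C_clone CT1 Ch fF).
Qed.
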